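(* Let $\mathbb{F}$ be a field of characteristic $0$. There is no family $(C_n)_{n \in \mathbb{N}}$ of arithmetic circuits over $\mathbb{F}$ such that, for every $n$, $C_n$ is $\mathrm{Alt}_n \times \mathrm{Alt}_n$-symmetric and computes the determinant $\det\big((x_{ij})_{i,j\in[n]}\big)$ of the $n\times n$ matrix of variables, and such that the size of $C_n$ is $2^{o(n)}$.
   Context: An arithmetic circuit over $\mathbb{F}$ for $n\times n$ matrices is a directed acyclic graph whose input gates are labelled by variables $x_{ij}$ ($i,j\in[n]$, $[n]=\{1,\dots,n\}$) or by constants from $\mathbb{F}$, whose internal gates are labelled by addition or multiplication, and which has a designated output gate; it computes a polynomial in the $x_{ij}$ in the usual way. Its size is its number of gates. The group $\mathrm{Sym}_n\times\mathrm{Sym}_n$ acts on the variables by $(\sigma,\pi)\cdot x_{ij}=x_{\sigma(i)\pi(j)}$. For a subgroup $G\le \mathrm{Sym}_n\times\mathrm{Sym}_n$, a circuit $C$ is $G$-symmetric if for every $g\in G$ the action of $g$ on the variable labels of the input gates extends to an automorphism of $C$ (a bijection on gates preserving wires, gate labels, constant labels and the output gate, and mapping an input gate labelled $x_{ij}$ to the input gate labelled $g\cdot x_{ij}$). $\mathrm{Alt}_n$ is the alternating group on $[n]$. *)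

(* Defs.v *)
From HB Require Import structures.
From mathcomp Require Import all_boot all_order all_algebra all_fingroup all_solvable.
From mathcomp Require Import mpoly.
Set Implicit Arguments. Unset Strict Implicit. Unset Printing Implicit Defensive.
Import GRing.Theory.
Local Open Scope ring_scope.

Definition xvar (F : fieldType) (n : nat) (i j : 'I_n) : {mpoly F[n * n]} :=
  'X_(mxvec_index i j).

Definition symb_mx (F : fieldType) (n : nat) : 'M[{mpoly F[n * n]}]_n :=
  \matrix_(i < n, j < n) xvar F i j.

Definition det_poly (F : fieldType) (n : nat) : {mpoly F[n * n]} :=
  \det (symb_mx F n).

Inductive glabel (F : fieldType) (n : nat) :=
  | GVar of 'I_n & 'I_n
  | GConst of F
  | GAdd
  | GMul.

(* An arithmetic circuit: gates are 'I_csize; cchild g is the set of gates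
   with a wire into g.  Acyclicity is enforced by a topological numbering
   (every wire goes from a smaller to a larger gate index), which is no loss
   of generality for finite DAGs.  Input gates (variables/constants) have no
   incoming wires. *)
Record circuit (F : fieldType) (n : nat) := Circuit {
  csize : nat;
  clabel : 'I_csize -> glabel F n;
  cchild : 'I_csize -> {set 'I_csize};
  cout : 'I_csize;
  cacyclic : forall g h : 'I_csize, h \in cchild g -> (h < g)%N;
  cinput : forall g : 'I_csize,
     match clabel g with GVar _ _ | GConst _ => cchild g = set0 | _ => True end
}.

Definition gate_val (F : fieldType) (n : nat) (C : circuit F n)
  (v : 'I_(csize C) -> {mpoly F[n * n]}) (g : 'I_(csize C)) : {mpoly F[n * n]} :=
  match clabel g with
  | GVar i j => xvar F i j
  | GConst c => c%:MP
  | GAdd => \sum_(h in cchild g) v h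
  | GMul => \prod_(h in cchild g) v h
  end.
Arguments gate_val {F n} C v g.

(* Polynomial computed at each gate: iterating the step csize times
   stabilises, since every gate has depth < csize. *)
Definition gate_poly (F : fieldType) (n : nat) (C : circuit F n) :
  'I_(csize C) -> {mpoly F[n * n]} :=
  iter (csize C) (gate_val C) (fun _ => 0).
Arguments gate_poly {F n} C.

Definition computes (F : fieldType) (n : nat) (C : circuit F n)
  (p : {mpoly F[n * n]}) : Prop :=
  gate_poly C (cout C) = p.

Definition act_label (F : fieldType) (n : nat) (s t : 'S_n) (l : glabel F n)
  : glabel F n :=
  match l with
  | GVar i j => GVar F (s i) (t j)
  | l' => l'
  end.

Definition is_automorphism (F : fieldType) (n : nat) (C : circuit F n)
  (s t : 'S_n) (sigma : {perm 'I_(csize C)}) : Prop :=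
  [/\ forall g, clabel (sigma g) = act_label s t (clabel g),
      forall g h, (h \in cchild g) = (sigma h \in cchild (sigma g))
    & sigma (cout C) = cout C].
Arguments is_automorphism {F n} C s t sigma.

Definition symmetric_wrt (F : fieldType) (n : nat) (G : {set 'S_n * 'S_n})
  (C : circuit F n) : Prop :=
  forall st, st \in G -> exists sigma, is_automorphism C st.1 st.2 sigma.

Definition AltxAlt (n : nat) : {set 'S_n * 'S_n} :=
  setX (Alt 'I_n) (Alt 'I_n).

(* size(C_n) = 2^{o(n)}, i.e. log2 size(C_n) / n -> 0, i.e. for every k >= 1,
   eventually size(C_n)^k <= 2^n. *)
Definition subexponential (f : nat -> nat) : Prop :=
  forall k : nat, (0 < k)%N -> exists N : nat, forall n : nat, (N <= n)%N ->
    (f n ^ k <= 2 ^ n)%N.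

(* Main.v *)
Require Import Defs.
From HB Require Import structures.
From mathcomp Require Import all_boot all_order all_algebra all_fingroup all_solvable.
From mathcomp Require Import mpoly.
From mathcomp Require Import zify.
Set Implicit Arguments. Unset Strict Implicit. Unset Printing Implicit Defensive.

(* Only the row symmetries Alt_n x 1 matter.  The stabiliser H of a gate in Alt_n
   has index at most the size of the circuit, so when the size is 2^o(n), H contains
   Alt(B) for a set B of n - o(n) points.  This makes the circuit fully symmetric:
   an odd permutation moving a gate can be corrected by a transposition of points of
   the set B of that gate, so that the value at each gate is invariant under
   transpositions of its B.  At the output this contradicts the fact that the
   determinant changes sign under a transposition of rows.

   For the support statement, let 2^m exceed the index of H in Sym_n.  Then for any
   disjoint P, Q of size m, the elementary abelian group generated by m disjoint
   transpositions between P and Q meets H.  Cut the points into blocks so that no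
   non-trivial element of H moves points of a certain proportional subset only to
   other blocks; then one block must contain all but O(m) points. *)

Lemma subset_of_card (T : finType) (A : {set T}) (k : nat) :
  k <= #|A| -> exists2 B : {set T}, B \subset A & #|B| = k.
Proof.
move=> kA; exists [set x in take k (enum A)].
  by apply/subsetP => x; rewrite inE => /mem_take; rewrite mem_enum.
rewrite cardsE (card_uniqP _) ?take_uniq ?enum_uniq //.
by rewrite size_takel // -cardE.
Qed.

(** * Permutation groups of small index: moved points, swaps, commutators *)

Section SmallIndex.
Import GroupScope.
Variable T : finType.
Implicit Types (x y : {perm T}) (P Q R X B Z : {set T}).

Definition moved x : {set T} := [set z | x z != z].

Lemma moved_perm x z : (x z \in moved x) = (z \in moved x).
Proof. by rewrite !inE (inj_eq perm_inj). Qed.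

Lemma moved_eq1 x : (moved x == set0) = (x == 1).
Proof.
apply/eqP/eqP => [x0|->]; last by apply/setP => z; rewrite !inE perm1 eqxx.
apply/permP => z; rewrite perm1; apply/eqP; apply: contraFT (in_set0 z).
by rewrite -x0 inE.
Qed.

Definition swaps P Q x := forall z, z \in moved x ->
  (z \in P) && (x z \in Q) || (z \in Q) && (x z \in P).

(** Generated by [m] disjoint transpositions matching points of [P] with points of [Q]. Induction
    adjoins one more, which centralises the others because they fix [p] and [q]. *)
Lemma swaps_group P Q (m : nat) :
  [disjoint P & Q] -> m <= #|P| -> m <= #|Q| ->
  exists2 K : {group {perm T}}, #|K| = (2 ^ m)%N & {in K, forall x, swaps P Q x}.
Proof.
elim: m P Q => [|m IH] P Q dPQ mP mQ.
  exists 1%G; first by rewrite cards1.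
  by move=> x /set1P-> z; rewrite inE perm1 eqxx.
have [p pP] : exists p, p \in P by apply/card_gt0P; lia.
have [q qQ] : exists q, q \in Q by apply/card_gt0P; lia.
have npq : p != q by apply: contraTneq pP => ->; rewrite (disjointFl dPQ).
have pQ : p \notin Q by rewrite (disjointFr dPQ).
have qP : q \notin P by rewrite (disjointFl dPQ).
have [||| K cK sK] := IH (P :\ p) (Q :\ q).
- by apply: disjointWl (subsetDl _ _) _; apply: disjointWr (subsetDl _ _) _.
- by move: mP; rewrite (cardsD1 p) pP; lia.
- by move: mQ; rewrite (cardsD1 q) qQ; lia.
have fixpq x : x \in K -> x p = p /\ x q = q.
  move=> xK; split; apply/eqP; apply: contraT => mv.
    have /= := sK x xK p; rewrite inE => /(_ mv).
    by rewrite !inE eqxx (negPf pQ) andbF.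
  have /= := sK x xK q; rewrite inE => /(_ mv).
  by rewrite !inE eqxx (negPf qP) andbF.
set t := tperm p q.
have cKt : <[t]> \subset 'C(K).
  rewrite cycle_subG; apply/centP => x xK; apply/commgP/conjg_fixP.
  by have [xp xq] := fixpq x xK; rewrite tpermJ xp xq.
have tK : t \notin K.
  apply/negP => /fixpq[/eqP]; rewrite tpermL eq_sym (negPf npq); done.
have ot : #[t] = 2.
  apply: nt_prime_order => //; first by rewrite expgS expg1 tperm2.
  by apply: contraNneq tK => ->; exact: group1.
exists (K <*> <[t]>)%G.
  rewrite /= cent_joinEr // TI_cardMg ?cK ?expnSr; first by rewrite -/(#[t]) ot.
  apply/trivgP/subsetP => x /setIP[xK] /=; rewrite cycle2g //.
  by rewrite !inE => /pred2P[->|xt] //; move: xK; rewrite xt (negPf tK).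
have inP x z : x \in K -> x z != z -> 
   [&& z \in P, z != p, x z \in Q & x z != q] || [&& z \in Q, z != q, x z \in P & x z != p].
  move=> xK xz; have /= := sK x xK z; rewrite inE => /(_ xz); rewrite !inE.
  by case/orP => /andP[/andP[-> ->] /andP[-> ->]]; rewrite // orbT.
move=> w; rewrite /= cent_joinEr // => /mulsgP[x u xK].
rewrite /= cycle2g // => /set2P uE -> z; case: uE => ->; rewrite inE ?mulg1 => mv.
  by case/orP: (inP x z xK mv) => /and4P[-> _ -> _]; rewrite ?orbT.
have [xp xq] := fixpq x xK.
have [->|zp] := eqVneq z p; first by rewrite permM xp tpermL pP qQ.
have [->|zq] := eqVneq z q; first by rewrite permM xq tpermR pP qQ orbT.
have xzp : x z != p by rewrite -[X in _ != X]xp (inj_eq perm_inj).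
have xzq : x z != q by rewrite -[X in _ != X]xq (inj_eq perm_inj).
have txz : t (x z) = x z by rewrite tpermD // eq_sym.
move: mv; rewrite permM txz => mv.
by case/orP: (inP x z xK mv) => /and4P[-> _ -> _]; rewrite ?orbT.
Qed.

(** Products act from left to right, so a point is followed through the inverses of [x] and [y],
    then [x] and [y]. Outside the three sets these moves cancel. *)
Lemma moved_commg x y :
  moved [~ x, y] \subset
    (moved x :&: moved y) :|: x @: (moved x :&: moved y) :|: y @: (moved x :&: moved y).
Proof.
apply/subsetP => p; rewrite inE => mv; rewrite !inE -orbA.
apply: contraR mv; rewrite !negb_or => /and3P[nXY nx ny].
rewrite commgEl conjgE !permM.
set q := x^-1 p.
have pE : p = x q by rewrite /q permKV.
have [qY|] := boolP (q \in moved y).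
  have qX : q \notin moved x.
    apply: contra nx => qX; rewrite pE; apply: imset_f; rewrite inE; exact/andP.
  have pq : p = q by move: qX; rewrite inE negbK -pE => /eqP.
  set r := y^-1 q.
  have qr : q = y r by rewrite /r permKV.
  have [rX|] := boolP (r \in moved x).
    case/negP: ny; rewrite pq qr; apply: imset_f.
    by rewrite inE rX -moved_perm -qr.
  by rewrite inE negbK => /eqP->; rewrite -qr pq.
rewrite inE negbK => /eqP yq.
have -> : y^-1 q = q by rewrite -{1}yq permK.
rewrite -pE; apply: contraR nXY => yp; rewrite yp andbT.
apply: contra yp => /eqP xp.
suff -> : p = q by rewrite yq.
by apply: (@perm_inj _ x); rewrite xp.
Qed.

(** * Sets [B] such that [H] contains Alt(B) *)

Variable H : {group {perm T}}.

(* Products of two transpositions of points of B generate Alt(B), so this says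
   Alt(B) <= H; the products themselves are what the circuit argument uses. *)
Definition alt_on B := [forall a in B, forall b in B, forall c in B, forall d in B,
  (a != b) && (c != d) ==> (tperm a b * tperm c d \in H)].

Lemma alt_onP B : reflect
  (forall a b c d, a \in B -> b \in B -> c \in B -> d \in B -> a != b -> c != d ->
     tperm a b * tperm c d \in H) (alt_on B).
Proof.
apply: (iffP idP) => [+ a b c d aB bB cB dB ab cd|h].
  move=> /forall_inP/(_ a aB)/forall_inP/(_ b bB)/forall_inP/(_ c cB).
  by move=> /forall_inP/(_ d dB); rewrite ab cd.
apply/forall_inP => a aB; apply/forall_inP => b bB; apply/forall_inP => c cB.
by apply/forall_inP => d dB; apply/implyP => /andP[ab cd]; apply: h.
Qed.

(* The transpositions of B lie in a single coset of H. *)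
Lemma alt_on_base B e f :
  (forall a b, a \in B -> b \in B -> a != b -> tperm a b * tperm e f \in H) ->
  alt_on B.
Proof.
move=> h; apply/alt_onP => a b c d aB bB cB dB ab cd.
have := groupM (h a b aB bB ab) (groupVr (h c d cB dB cd)).
by rewrite invMg !tpermV mulgA -(mulgA (tperm a b)) tperm2 mulg1.
Qed.

(** Conjugation by [y] turns (z u)(u v) into (w u)(u v) for [u], [v] fixed by [y], where [w] is
    [y z]. Elements of Alt(B) then carry this to every point of [B]. *)
Lemma alt_on_add B y z :
  2 < #|B| -> alt_on B -> y \in H -> z \in B ->
  1 < #|[set e in B | (e != z) && (y e == e)]| -> y z \notin B -> alt_on (y z |: B).
Proof.
move=> B3 /alt_onP aB yH zB /card_gt1P[e [f [+ + ef]]] wB; rewrite !inE.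
move=> /and3P[eB ez /eqP ye] /and3P[fB fz /eqP yf].
set w := y z in wB *.
have neB u : u \in B -> w != u by apply: contraTneq => <-.
have wH u v : u \in B -> u != z -> y u = u -> v \in B -> v != z -> y v = v -> u != v ->
    tperm w u * tperm u v \in H.
  move=> uB uz yu vB vz yv uv.
  rewrite /w -{1 2}yu -{1}yv -!tpermJ -conjMg groupJ //.
  by apply: aB => //; rewrite eq_sym.
have weH := wH e f eB ez ye fB fz yf ef.
have wfH : tperm w f * tperm e f \in H by rewrite [tperm e f]tpermC wH // eq_sym.
apply: (@alt_on_base _ e f).
have main a : a \in B -> tperm w a * tperm e f \in H.
  move=> aIn; have [->//|ae] := eqVneq a e; have [->//|af] := eqVneq a f.
  (* [g] sends [e] to [a] and [f] to [e], and fixes [w]: it conjugates (w e)(e f) into (w a)(a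
     e). *)
  set g := tperm e f * tperm f a.
  have gH : g \in H by apply: aB => //; rewrite eq_sym.
  have ge : g e = a by rewrite permM !tpermL.
  have gf : g f = e by rewrite permM tpermR tpermD // eq_sym.
  have gw : g w = w by rewrite permM !tpermD // eq_sym neB.
  have := groupJ weH gH; rewrite conjMg !tpermJ ge gf gw => h1.
  have h2 : tperm e a * tperm e f \in H by apply: aB; rewrite // eq_sym.
  by have := groupM h1 h2; rewrite [tperm a e]tpermC mulgA -(mulgA (tperm w a)) tperm2 mulg1.
move=> a b /setU1P[->|aIn] /setU1P[->|bIn] ab.
- by rewrite eqxx in ab.
- exact: main.
- by rewrite tpermC; apply: main.
- exact: aB.
Qed.

(** The 3-cycle is both (a b)(a c) and (b c)(b a), which puts the three transpositions into one
    coset of [H]. *)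
Lemma alt_on_3cycle x a b c :
  x \in H -> moved x = [set a; b; c] -> x a = b -> x b = c -> x c = a ->
  a != b -> b != c -> a != c -> alt_on [set a; b; c].
Proof.
move=> xH mx xa xb xc ab bc ac.
have xfix z : z != a -> z != b -> z != c -> x z = z.
  move=> za zb zc; apply/eqP; apply: contraT => mv.
  have : z \in moved x by rewrite inE.
  by rewrite mx !inE (negPf za) (negPf zb) (negPf zc).
have x1 : x = tperm a b * tperm a c.
  apply/permP => z; rewrite permM.
  have [->|za] := eqVneq z a; first by rewrite xa tpermL tpermD // eq_sym.
  have [->|zb] := eqVneq z b; first by rewrite xb tpermR tpermL.
  have [->|zc] := eqVneq z c; first by rewrite xc (tpermD ac bc) tpermR.
  by rewrite xfix // !tpermD // eq_sym.
have x2 : x = tperm b c * tperm b a.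
  apply/permP => z; rewrite permM.
  have [->|za] := eqVneq z a; first by rewrite xa (@tpermD _ b c a) ?tpermR // eq_sym.
  have [->|zb] := eqVneq z b; first by rewrite xb tpermL tpermD // eq_sym.
  have [->|zc] := eqVneq z c; first by rewrite xc tpermR tpermL.
  by rewrite xfix // !tpermD // eq_sym.
have h2 : tperm b c * tperm a b \in H by rewrite [tperm a b]tpermC -x2.
have h3 : tperm a c * tperm a b \in H.
  by rewrite -groupV invMg !tpermV -x1.
have h1 : tperm a b * tperm a b \in H by rewrite tperm2 group1.
apply: (@alt_on_base _ a b) => u v.
rewrite !inE -!orbA => /or3P[]/eqP-> /or3P[]/eqP-> //; rewrite ?eqxx // => _.
- by rewrite [tperm b a]tpermC.
- by rewrite [tperm c a]tpermC.
- by rewrite [tperm c b]tpermC.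
Qed.

(** The condition for peeling off a block: [R] is what remains to be partitioned, [B] the block, and
    [Z] its share of the points that test elements may move. *)
Definition separating R B Z := forall y, y \in H -> moved y \subset R ->
  moved y :&: B \subset Z -> (forall z, z \in moved y -> z \in B -> y z \notin B) ->
  [disjoint moved y & B].

(* A block of maximal size with Alt(B) <= H: an element moving a point of B out
   of B and fixing two points of B would allow B to be enlarged. *)
Lemma separating_block_alt R B :
  B \subset R -> 2 < #|B| -> alt_on B ->
  (forall E : {set T}, E \subset R -> 2 < #|E| -> alt_on E -> #|E| <= #|B|) ->
  exists2 Z : {set T}, Z \subset B & #|B| <= 6 * #|Z| /\ separating R B Z.
Proof.
move=> BR B3 aB maxB.
(* The two points left out are fixed by [y], as [alt_on_add] requires. *)
have [|Z ZB cZ] := @subset_of_card _ B (#|B| - 2); first by rewrite leq_subr.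
exists Z => //; split; first by rewrite cZ; move: B3; clear; lia.
move=> y yH yR yZ out; apply/pred0P => z /=; apply/negP => /andP[zy zB].
have wB := out z zy zB.
have fixB e : e \in B :\: Z -> y e = e.
  case/setDP => eB; apply: contraNeq => ye.
  by apply: (subsetP yZ); rewrite !inE ye.
have zZ : z \in Z by apply: (subsetP yZ); rewrite inE zy.
suff aB' : alt_on (y z |: B).
  have : y z |: B \subset R by rewrite subUset BR sub1set (subsetP yR) // moved_perm.
  move=> /maxB; rewrite cardsU1 wB => /(_ (leqW B3) aB').
  by rewrite ltnn.
apply: alt_on_add => //.
have /subset_leq_card : B :\: Z \subset [set e in B | (e != z) && (y e == e)].
  apply/subsetP => e eBZ; rewrite inE fixB // eqxx andbT.
  by case/setDP: eBZ => -> eZ; apply: contraNneq eZ => ->.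
by rewrite cardsD (setIidPr ZB) cZ subKn // ltnW.
Qed.

(** At most one transposition is available, and its square is 1. *)
Lemma alt_on_subset B : #|B| <= 2 -> alt_on B.
Proof.
move=> B2; apply/alt_onP => a b c d aB bB cB dB ab cd.
suff -> : tperm c d = tperm a b by rewrite tperm2 group1.
have /eqP BE : [set a; b] == B.
  by rewrite eqEcard subUset !sub1set aB bB cards2 ab.
move: cB dB; rewrite -BE !inE => /orP[]/eqP cE /orP[]/eqP dE; move: cd.
- by rewrite cE dE eqxx.
- by rewrite cE dE.
- by rewrite cE dE tpermC.
- by rewrite cE dE eqxx.
Qed.

Hypothesis HAlt : H \subset 'Alt_T.

(** Elements of [H] are even, so [x] is not a transposition; if it moved just three points it would
    be a 3-cycle, covered by [alt_on_3cycle]. *)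
Lemma moved_gt3 x : x \in H -> x != 1 -> ~~ ((2 < #|moved x|) && alt_on (moved x)) -> 3 < #|moved x|.
Proof.
move=> xH x1 nalt.
have [a aX] : exists a, a \in moved x by apply/set0Pn; rewrite moved_eq1.
have ab : x a != a by move: aX; rewrite inE.
have bX : x a \in moved x by rewrite moved_perm.
have [xb|ac] := eqVneq (x (x a)) a.
  have xt : x != tperm a (x a).
    apply: contraTneq (subsetP HAlt x xH) => ->.
    by rewrite Alt_even odd_tperm eq_sym ab.
  have [z] : exists z, x z != tperm a (x a) z.
    apply/existsP; apply: contraR xt; rewrite negb_exists => /forallP h.
    by apply/eqP/permP => z; move: (h z); rewrite negbK => /eqP.
  have [->|za] := eqVneq z a; first by rewrite tpermL eqxx.
  have [->|zb] := eqVneq z (x a); first by rewrite tpermR xb eqxx.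
  rewrite tpermD 1?eq_sym // 1?eq_sym // => xz.
  have sub : a |: (x a |: [set z; x z]) \subset moved x.
    by rewrite !subUset !sub1set aX bX moved_perm !inE xz.
  have xza : x z != a by rewrite -xb (inj_eq perm_inj).
  have xzb : x z != x a by rewrite (inj_eq perm_inj).
  apply: leq_trans (subset_leq_card sub).
  rewrite !cardsU1 cards1 !inE !negb_or (eq_sym a) (eq_sym a z) (eq_sym a (x z)).
  by rewrite (eq_sym (x a) z) (eq_sym (x a) (x z)) (eq_sym z (x z)) ab za xza zb xzb xz.
have cX : x (x a) \in moved x by rewrite moved_perm.
have bc : x a != x (x a) by rewrite eq_sym (inj_eq perm_inj).
set S := [set a; x a; x (x a)].
have SX : S \subset moved x by rewrite !subUset !sub1set aX bX cX.
have cS : #|S| = 3.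
  by rewrite /S -setUA !cardsU1 cards1 !inE negb_or eq_sym ab eq_sym ac bc.
rewrite ltn_neqAle -{2}cS subset_leq_card // andbT.
apply: contra nalt => /eqP X3.
have mS : moved x = S by apply/eqP; rewrite eq_sym eqEcard SX cS -X3 leqnn.
rewrite mS cS /=; apply: (@alt_on_3cycle x) => //; rewrite 1?eq_sym //.
have : x (x (x a)) \in S by rewrite -mS moved_perm.
by rewrite !inE -orbA => /or3P[/eqP//|/eqP/perm_inj/eqP|/eqP/perm_inj/eqP];
  [rewrite (negPf ac) | rewrite eq_sym (negPf bc)].
Qed.

(* The support of an x of minimal support: if y moves fewer than a third of its
   points, some of them out of it, then [x, y] <> 1 has smaller support. *)
Lemma separating_block_moved R x :
  x \in H -> 3 < #|moved x| -> moved x \subset R ->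
  (forall y, y \in H -> y != 1 -> moved y \subset R -> #|moved x| <= #|moved y|) ->
  exists2 Z : {set T}, Z \subset moved x &
    #|moved x| <= 6 * #|Z| /\ separating R (moved x) Z.
Proof.
move=> xH X3 XR minX.
(* The commutator moves at most 3 #|Z| points, which must be fewer than [x] moves. After rounding,
   the ratio 6 is attained when [x] moves six points. *)
have [|Z ZX cZ] := @subset_of_card _ (moved x) (#|moved x|.-1 %/ 3).
  by apply: leq_trans (leq_div _ _) (leq_pred _).
exists Z => //; split; first by rewrite cZ; move: X3; clear; lia.
move=> y yH yR yZ out; apply/pred0P => z /=; apply/negP => /andP[zy zX].
have wX := out z zy zX.
(* If [x] and [y] commuted, [y] would preserve the support of [x], but it takes [z] out of it. *)
have u1 : [~ x, y] != 1.
  apply: contraNneq wX => /eqP/conjg_fixP xy.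
  by rewrite inE -{1}xy permJ (inj_eq perm_inj); move: zX; rewrite inE.
have uR : moved [~ x, y] \subset R.
  apply: subset_trans (moved_commg x y) _; rewrite !subUset -andbA; apply/and3P; split.
  - by apply: subset_trans XR; exact: subsetIl.
  - apply: subset_trans XR; apply/subsetP => _ /imsetP[u /setIP[uX _] ->].
    by rewrite moved_perm.
  - apply: subset_trans yR; apply/subsetP => _ /imsetP[u /setIP[_ uY] ->].
    by rewrite moved_perm.
have := minX _ (groupR xH yH) u1 uR; apply/negP; rewrite -ltnNge.
apply: leq_ltn_trans (subset_leq_card (moved_commg x y)) _.
have cI : #|moved x :&: moved y| <= #|Z| by rewrite setIC subset_leq_card.
set I := moved x :&: moved y in cI *.
apply: (@leq_ltn_trans (3 * #|Z|)); last by rewrite cZ; move: X3; clear; lia.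
apply: leq_trans (leq_card_setU _ _) _.
rewrite (_ : (3 * #|Z| = #|Z| + #|Z| + #|Z|)%N); last by rewrite !mulSn addn0 addnA.
apply: leq_add; last exact: leq_trans (leq_imset_card _ _) cI.
apply: leq_trans (leq_card_setU _ _) _; apply: leq_add => //.
exact: leq_trans (leq_imset_card _ _) cI.
Qed.

(** If [K] met [H] trivially, their product set would have more than #|T|! elements. *)
Lemma swaps_in_subgroup (m : nat) P Q :
  #|T|`! < 2 ^ m * #|H| -> [disjoint P & Q] -> m <= #|P| -> m <= #|Q| ->
  exists2 y, y \in H & y != 1 /\ swaps P Q y.
Proof.
move=> Hm dPQ mP mQ; have [K cK sK] := swaps_group dPQ mP mQ.
have /trivgPn[y /setIP[yK yH] y1] : K :&: H != 1.
  apply/negP => /eqP KH; have := mul_cardG K H.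
  rewrite cK KH cards1 muln1 => e; move: Hm.
  rewrite e ltnNge -card_Sym; case/negP; apply: subset_leq_card.
  by apply/subsetP => g _; rewrite inE.
by exists y => //; split=> //; exact: sK.
Qed.

(** * Partition into separating blocks, one of which is large *)

Variable m : nat.
Hypothesis swapsH : forall P Q, [disjoint P & Q] -> m <= #|P| -> m <= #|Q| ->
  exists2 y, y \in H & y != 1 /\ swaps P Q y.

(** The block is a largest [alt_on] set of at least three points in [R]; failing that, a smallest
    support in [R] of a non-trivial element of [H]; failing that, a single point. *)
Lemma separating_block R : R != set0 ->
  exists B Z : {set T}, [/\ B \subset R, B != set0, Z \subset B & #|B| <= 6 * #|Z|]
    /\ (#|B| <= 2 * m \/ alt_on B) /\ separating R B Z.
Proof.
move=> R0.
have [/existsP[E0 E0P]|noE] :=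
    boolP [exists E : {set T}, [&& E \subset R, 2 < #|E| & alt_on E]].
  pose good (E : {set T}) := [&& E \subset R, 2 < #|E| & alt_on E].
  case: (@arg_maxnP _ E0 good (fun E : {set T} => #|E|) E0P) => B /and3P[BR B3 aB] maxB.
  have [E ER E3 aE|Z ZB [cZ sZ]] := @separating_block_alt R B BR B3 aB.
    by apply: maxB; apply/and3P.
  by exists B, Z; split; [split=> //; rewrite -card_gt0; exact: leq_trans B3 | split=> //; right].
pose inR x := [&& x \in H, x != 1 & moved x \subset R].
have [/existsP[x0 x0P]|nox] := boolP [exists x, inR x]; last first.
  have [r rR] := set0Pn _ R0.
  exists [set r], [set r]; split.
    by rewrite sub1set rR cards1; split=> //; apply/set0Pn; exists r; rewrite inE.
  split; first by right; apply: alt_on_subset; rewrite cards1.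
  move=> y yH yR _ _; suff /eqP -> : moved y == set0 by rewrite -setI_eq0 set0I.
  rewrite moved_eq1; apply: contraR nox => y1; apply/existsP; exists y.
  by rewrite /inR yH y1.
case: (@arg_minnP _ x0 inR (fun x => #|moved x|) x0P) => x /and3P[xH x1 xR] minx.
have x3 : 3 < #|moved x|.
  apply: moved_gt3 => //; apply: contra noE => ax.
  by apply/existsP; exists (moved x); rewrite xR.
have minH y : y \in H -> y != 1 -> moved y \subset R -> #|moved x| <= #|moved y|.
  by move=> yH y1 yR; apply: minx; apply/and3P.
have [Z ZX [cZ sZ]] := separating_block_moved xH x3 xR minH.
exists (moved x), Z; split; first by split=> //; rewrite moved_eq1.
split=> //; left; rewrite leqNgt; apply/negP => big.
(* There is room in [R] for disjoint [P] and [Q] of size [m]; a swap between them in [H] moves at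
   most 2m points, against minimality. *)
have Rm : 2 * m <= #|R| by apply: leq_trans (subset_leq_card xR); exact: ltnW.
have [|P PR cP] := @subset_of_card _ R m; first by move: Rm; clear; lia.
have [|Q QR cQ] := @subset_of_card _ (R :\: P) m.
  by rewrite cardsD (setIidPr PR) cP; move: Rm; clear; lia.
have dPQ : [disjoint P & Q].
  by rewrite disjoint_sym; apply: disjointWl QR _; rewrite -setI_eq0 setDE -setIA [~: P :&: P]setIC setICr setI0.
have [||y yH [y1 sy]] := @swapsH P Q dPQ; rewrite ?cP ?cQ //.
have yPQ : moved y \subset P :|: Q.
  apply/subsetP => z /sy; rewrite inE.
  by case/orP => /andP[-> _]; rewrite ?orbT.
have PQR : P :|: Q \subset R.
  by rewrite subUset PR (subset_trans QR) // subsetDl.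
have := minx y; rewrite /inR yH y1 (subset_trans yPQ PQR) => /(_ isT).
apply/negP; rewrite -ltnNge; apply: leq_ltn_trans big.
apply: leq_trans (subset_leq_card yPQ) _.
by apply: leq_trans (leq_card_setU _ _) _; rewrite cP cQ addnn mul2n.
Qed.

(* Peeling off separating blocks one after the other: an element of H moving only
   points of Z, each to another block, cannot touch the first block, hence not the
   second one, and so on. *)
Lemma separating_blocks R : exists (blk : T -> nat) (Z : {set T}),
  [/\ Z \subset R, #|R| <= 6 * #|Z|,
    forall i, #|[set z in R | blk z != i]| <= 6 * #|[set z in Z | blk z != i]|,
    forall i, #|[set z in R | blk z == i]| <= 2 * m \/ alt_on [set z in R | blk z == i]
    & forall y, y \in H -> moved y \subset Z ->
       (forall z, z \in moved y -> blk (y z) != blk z) -> y = 1].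
Proof.
have [k] := ubnP #|R|; elim: k R => // k IH R Rk.
have [->|R0] := eqVneq R set0.
  exists (fun=> 0), set0; split; rewrite ?cards0 //.
  - by move=> i; rewrite (_ : [set z in _ | _] = set0) ?cards0 //; apply/setP => z; rewrite !inE.
  - by move=> i; left; rewrite (_ : [set z in _ | _] = set0) ?cards0 //; apply/setP => z; rewrite !inE.
  - by move=> y yH; rewrite subset0 moved_eq1 => /eqP.
have [B [Z [[BR B0 ZB cB] [altB sepB]]]] := separating_block R0.
have cRB : #|R :\: B| < k.
  by rewrite cardsD (setIidPr BR); move: B0; rewrite -card_gt0; have := subset_leq_card BR; lia.
have [blk [Y [YR cY cbY altY sepY]]] := IH _ cRB.
have YnB z : z \in Y -> z \notin B by move/(subsetP YR); rewrite inE => /andP[].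
(* The new block gets index 0 and the later blocks are shifted by one. *)
pose blk' z := if z \in B then 0 else (blk z).+1.
have RE : R = B :|: (R :\: B) by rewrite -{1}(setID R B) (setIidPr BR).
have blk0 : [set z in R | blk' z == 0] = B.
  apply/setP => z; rewrite inE /blk'; case: (boolP (z \in B)) => zB; last by rewrite andbF.
  by rewrite (subsetP BR).
have blkS i : [set z in R | blk' z == i.+1] = [set z in R :\: B | blk z == i].
  by apply/setP => z; rewrite !inE /blk'; case: (z \in B); rewrite ?andbF.
have dBR (A A' : {set T}) : A \subset B -> A' \subset R :\: B -> #|A :|: A'| = #|A| + #|A'|.
  move=> AB AR; apply/eqP; rewrite leq_card_setU; apply: disjointWl AB _.
  by apply: disjointWr AR _; rewrite disjoint_sym -setI_eq0 setDE -setIA [~: B :&: B]setIC setICr setI0.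
exists blk', (Z :|: Y); split.
- by rewrite subUset (subset_trans ZB BR) (subset_trans YR (subsetDl _ _)).
- by rewrite RE !dBR // mulnDr leq_add.
- case=> [|i].
    have -> : [set z in R | blk' z != 0] = R :\: B.
      by apply/setP => z; rewrite !inE /blk'; case: (z \in B); rewrite ?andbF ?andbT.
    have -> : [set z in Z :|: Y | blk' z != 0] = Y.
      apply/setP => z; rewrite !inE /blk'; case: (boolP (z \in B)) => zB; rewrite ?andbF ?andbT.
        by apply/esym/negP => /YnB; rewrite zB.
      by have -> : z \in Z = false by apply/negP => /(subsetP ZB); rewrite (negPf zB).
    exact: cY.
  have -> : [set z in R | blk' z != i.+1] = B :|: [set z in R :\: B | blk z != i].
    apply/setP => z; rewrite !inE /blk'; case: (boolP (z \in B)) => zB //=; rewrite ?andbT.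
    exact: (subsetP BR).
  have -> : [set z in Z :|: Y | blk' z != i.+1] = Z :|: [set z in Y | blk z != i].
    apply/setP => z; rewrite !inE /blk'; case: (boolP (z \in B)) => zB //=; rewrite ?andbT.
      by have -> : z \in Y = false by apply/negP => /YnB; rewrite zB.
    by have -> : z \in Z = false by apply/negP => /(subsetP ZB); rewrite (negPf zB).
  rewrite !dBR // ?mulnDr ?leq_add //.
  + by apply/subsetP => z; rewrite inE => /andP[/(subsetP YR)].
  + by apply/subsetP => z; rewrite inE => /andP[].
- by case=> [|i]; rewrite ?blk0 ?blkS.
move=> y yH yZY sy.
have dYB : [disjoint moved y & B].
  apply: sepB => //.
  - by apply: subset_trans yZY _; rewrite subUset (subset_trans ZB BR) (subset_trans YR (subsetDl _ _)).
  - apply/subsetP => z /setIP[/(subsetP yZY)/setUP[//|/YnB]] nB zB.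
    by rewrite zB in nB.
  - move=> z zy zB; apply/negP => yzB; move: (sy z zy).
    by rewrite /blk' zB yzB.
have nB z : z \in moved y -> z \notin B by move/(disjointFr dYB) => ->.
apply: sepY => //.
  apply/subsetP => z zy; case/setUP: (subsetP yZY z zy) => // /(subsetP ZB) zB.
  by move: (nB z zy); rewrite zB.
move=> z zy; move: (sy z zy); rewrite /blk' (negPf (nB z zy)) (negPf (nB _ _)) ?eqSS //.
by rewrite moved_perm.
Qed.

(** Cut at the first index [i] up to which [Z] has [m] points. Fewer than [m] lie beyond, else [H]
    would contain a swap across the cut, and at most [m] lie before. The ratio 6 leaves at most 12m
    points outside block [i], hence more than 2m inside. *)
Lemma alt_on_large : 14 * m < #|T| -> exists2 B : {set T}, #|~: B| <= 12 * m & alt_on B.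
Proof.
move=> Tm; have [blk [Z [_ cZ cbZ altZ sepZ]]] := separating_blocks setT.
pose U i := [set z in Z | blk z <= i].
have split_blk i : m <= #|U i| -> #|Z :\: U i| < m.
  move=> mU; rewrite ltnNge; apply/negP => mV.
  have dU : [disjoint U i & Z :\: U i].
    by rewrite -setI_eq0 setIDA setIC -setIDA setDv setI0.
  have [y yH [/eqP y1 sy]] := swapsH dU mU mV.
  case: y1; apply: sepZ => //.
    by apply/subsetP => z /sy; rewrite !inE => /orP[]/andP[]; [case/andP | move=> /andP[]].
  move=> z /sy; rewrite !inE.
  case/orP => /andP[].
    move=> /andP[_ zi] /andP[+ yZ]; rewrite yZ -ltnNge => iy.
    by rewrite gtn_eqF // (leq_ltn_trans zi).
  move=> /andP[+ zZ] /andP[_ yi]; rewrite zZ -ltnNge => iz.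
  by rewrite ltn_eqF // (leq_ltn_trans yi).
have exi : exists i, m <= #|U i|.
  exists (\max_z blk z); have -> : U (\max_z blk z) = Z.
    by apply/setP => z; rewrite inE leq_bigmax andbT.
  by rewrite cardsT in cZ; lia.
case: (ex_minnP exi) => i mi mini.
have cV := split_blk i mi.
have cW : #|[set z in Z | blk z < i]| <= m.
  case: i mi mini {cV} => [|i] mi mini.
    by rewrite (_ : [set z in _ | _] = set0) ?cards0 //; apply/setP => z; rewrite !inE andbF.
  by rewrite ltnW // ltnNge; apply/negP => /mini; rewrite ltnn.
have cout : #|[set z in Z | blk z != i]| <= 2 * m.
  have : [set z in Z | blk z != i] \subset [set z in Z | blk z < i] :|: (Z :\: U i).
    by apply/subsetP => z; rewrite !inE => /andP[-> ]; lia.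
  move/subset_leq_card/leq_trans; apply; apply: leq_trans (leq_card_setU _ _) _; lia.
pose B := [set z in [set: T] | blk z == i].
have cB : #|~: B| <= 12 * m.
  have -> : ~: B = [set z in [set: T] | blk z != i] by apply/setP => z; rewrite !inE.
  by apply: leq_trans (cbZ i) _; lia.
exists B => //; case: (altZ i) => //; rewrite -/B => Bm.
by have := cardsC B; lia.
Qed.

End SmallIndex.

(** * Decidable equality of gate labels, which makes [row_aut] a boolean predicate *)

Section LabelEq.
Variables (F : fieldType) (n : nat).

Definition glabel_code (l : glabel F n) : ('I_n * 'I_n) + (F + bool) :=
  match l with
  | GVar i j => inl (i, j)
  | GConst c => inr (inl c)
  | GAdd => inr (inr true)
  | GMul => inr (inr false)
  end.

Definition glabel_decode (c : ('I_n * 'I_n) + (F + bool)) : glabel F n :=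
  match c with
  | inl (i, j) => GVar F i j
  | inr (inl c) => GConst n c
  | inr (inr b) => if b then GAdd F n else GMul F n
  end.

Lemma glabel_codeK : cancel glabel_code glabel_decode.
Proof. by case. Qed.

HB.instance Definition _ := Equality.copy (glabel F n) (can_type glabel_codeK).

End LabelEq.

(** * Automorphisms over row permutations and stabilisers of gates *)

Section RowSymmetry.
Import GroupScope GRing.Theory.
Variables (F : fieldType) (n : nat) (C : circuit F n).
Implicit Types (s t p : 'S_n) (sigma tau : {perm 'I_(csize C)}) (g h : 'I_(csize C)).

Definition row_aut s sigma :=
  [&& [forall g, clabel (sigma g) == act_label s 1 (clabel g)],
      [forall g, forall h, (h \in cchild g) == (sigma h \in cchild (sigma g))]
    & sigma (cout C) == cout C].

Lemma row_autP s sigma : reflect (is_automorphism C s 1 sigma) (row_aut s sigma).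
Proof.
apply: (iffP and3P) => -[h1 h2 h3].
  split; [by move=> g; apply/eqP/(forallP h1) | | exact/eqP].
  by move=> g h; apply/eqP; have /forallP := forallP h2 g; apply.
split; [by apply/forallP => g; apply/eqP | | exact/eqP].
by apply/forallP => g; apply/forallP => h; apply/eqP.
Qed.

Lemma row_aut1 : row_aut 1 1.
Proof.
apply/row_autP; split=> [g|g h|]; rewrite !perm1 //.
by case: (clabel g) => //= i j; rewrite !perm1.
Qed.

Lemma row_autM s t sigma tau :
  row_aut s sigma -> row_aut t tau -> row_aut (s * t) (sigma * tau).
Proof.
move=> /row_autP[s1 s2 s3] /row_autP[t1 t2 t3].
apply/row_autP; split=> [g|g h|]; rewrite !permM ?s3 // -?t2 //.
by rewrite t1 s1; case: (clabel g) => //= i j; rewrite permM !perm1.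
Qed.

Lemma row_autV s sigma : row_aut s sigma -> row_aut s^-1 sigma^-1.
Proof.
move=> /row_autP[s1 s2 s3]; apply/row_autP; split=> [g|g h|].
- have := s1 (sigma^-1 g); rewrite permKV => ->.
  by case: (clabel _) => //= i j; rewrite !perm1 permK.
- by rewrite [RHS]s2 !permKV.
- by rewrite -{1}s3 permK.
Qed.

(** Several automorphisms may extend one [s], so there need be no canonical action on gates; it is
    enough that some extension fixes [g]. *)
Definition row_stab g : {set 'S_n} :=
  [set s in 'Alt_('I_n) | [exists sigma, row_aut s sigma && (sigma g == g)]].

Lemma row_stabP g s :
  reflect (s \in 'Alt_('I_n) /\ exists2 sigma, row_aut s sigma & sigma g = g)
    (s \in row_stab g).
Proof.
rewrite [s \in row_stab g]inE; apply: (iffP andP) => -[sA].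
  by case/existsP => sigma /andP[sa /eqP sg]; split=> //; exists sigma.
by case=> sigma sa sg; split=> //; apply/existsP; exists sigma; rewrite sa sg eqxx.
Qed.

Lemma row_stab_group_set g : group_set (row_stab g).
Proof.
apply/group_setP; split.
  by apply/row_stabP; split; [exact: group1 | exists 1; [exact: row_aut1 | rewrite perm1]].
move=> s t /row_stabP[sA [sigma ss sg]] /row_stabP[tA [tau tt tg]].
apply/row_stabP; split; first exact: groupM.
by exists (sigma * tau); [exact: row_autM | rewrite permM sg].
Qed.

Canonical row_stab_group g := Group (row_stab_group_set g).

(** Orbit counting without an action: each [fib h] lies in a right coset of the stabiliser, and by
    symmetry these possibly overlapping sets cover Alt_n. *)
Lemma card_row_stab g : symmetric_wrt (AltxAlt n) C ->
  #|'Alt_('I_n)| <= csize C * #|row_stab g|.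
Proof.
move=> symC.
pose fib h := [set s in 'Alt_('I_n) | [exists sigma, row_aut s sigma && (sigma g == h)]].
have fib_le h : #|fib h| <= #|row_stab g|.
  have [->|[s0]] := set_0Vmem (fib h); first by rewrite cards0.
  rewrite inE => /andP[sA0 /existsP[sigma0 /andP[sa0 /eqP sg0]]].
  rewrite -(card_rcoset (row_stab g) s0); apply: subset_leq_card.
  apply/subsetP => s; rewrite inE => /andP[sA /existsP[sigma /andP[sa /eqP sg]]].
  rewrite mem_rcoset; apply/row_stabP; split; first by rewrite groupM ?groupV.
  exists (sigma * sigma0^-1); first by apply: row_autM => //; exact: row_autV.
  by rewrite permM sg -sg0 permK.
have cover : 'Alt_('I_n) \subset \bigcup_h fib h.
  apply/subsetP => s sA.
  have /symC[sigma /row_autP sa] : (s, 1) \in AltxAlt n by rewrite inE /= sA group1.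
  apply/bigcupP; exists (sigma g) => //; rewrite inE sA; apply/existsP; exists sigma.
  by rewrite sa eqxx.
apply: leq_trans (subset_leq_card cover) _.
have le_cup : #|\bigcup_h fib h| <= \sum_h #|fib h|.
  elim/big_rec2: _ => [|h u A _ IH]; first by rewrite cards0.
  by apply: leq_trans (leq_card_setU _ _) _; rewrite leq_add2l.
apply: leq_trans le_cup _.
apply: (@leq_trans (\sum_(h < csize C) #|row_stab g|)); first by apply: leq_sum => h _.
by rewrite sum_nat_const card_ord.
Qed.

(* The polynomials are only evaluated at permutation matrices, where the action of
   row permutations becomes left translation on 'S_n. *)
Definition perm_val (k : nat) g : {ffun 'S_n -> F} :=
  [ffun p => (iter k (gate_val C) (fun=> 0%R) g).@[fun e => mxvec (perm_mx p) ord0 e]]%R.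

Lemma perm_valS k g p : perm_val k.+1 g p =
  match clabel g with
  | GVar i j => (p i == j)%:R
  | GConst c => c
  | GAdd => \sum_(h in cchild g) perm_val k h p
  | GMul => \prod_(h in cchild g) perm_val k h p
  end%R.
Proof.
rewrite ffunE /= {1}/gate_val; case: (clabel g) => [i j|c||].
- by rewrite mevalXU mxvecE !mxE.
- by rewrite mevalC.
- by rewrite rmorph_sum; apply: eq_bigr => h _; rewrite ffunE.
- by rewrite rmorph_prod; apply: eq_bigr => h _; rewrite ffunE.
Qed.

Lemma perm_val_aut k s sigma g p :
  row_aut s sigma -> perm_val k (sigma g) p = perm_val k g (s * p).
Proof.
move=> /row_autP[s1 s2 s3]; elim: k g => [|k IH] g; first by rewrite !ffunE /= !rmorph0.
rewrite !perm_valS s1; case: (clabel g) => [i j|c||] //=.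
- by rewrite permM perm1.
- rewrite (reindex_inj (@perm_inj _ sigma)); apply: eq_big => [h|h _]; first by rewrite -s2.
  exact: IH.
- rewrite (reindex_inj (@perm_inj _ sigma)); apply: eq_big => [h|h _]; first by rewrite -s2.
  exact: IH.
Qed.

(* To move a child h of g by the odd permutation (a b), multiply (a b) by a
   transposition (c d) that fixes the value of h: the product is even, lies in the
   stabiliser of g, and hence permutes the children of g.  As (c d) depends on h,
   the multisets of values are compared one value q at a time. *)
Lemma perm_val_tperm (B : 'I_(csize C) -> {set 'I_n}) :
  (forall g, alt_on (row_stab_group g) (B g)) ->
  (forall g h, 2 < #|B g :&: B h|) ->
  forall k g a b p, a \in B g -> b \in B g -> a != b ->
    perm_val k g (tperm a b * p) = perm_val k g p.
Proof.
move=> altB capB; elim=> [|k IH] g a b p aB bB ab; first by rewrite !ffunE /= !rmorph0.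
have /alt_onP altg := altB g.
pose tv (q : {ffun 'S_n -> F}) := [ffun r => q (tperm a b * r)].
have tvE q r : tv q r = q (tperm a b * r) by rewrite ffunE.
have tvK : involutive tv.
  by move=> q; apply/ffunP => r; rewrite !tvE mulgA tperm2 mul1g.
(* [N q] is the multiplicity of [q] among the values of the children; sums and products depend only
   on these. *)
pose N q := #|[set h in cchild g | perm_val k h == q]|.
have leN q : N q <= N (tv q).
  rewrite {1}/N; have [->|[h0]] := set_0Vmem [set h in cchild g | perm_val k h == q].
    by rewrite cards0.
  rewrite inE => /andP[_ /eqP vh0].
  have /card_gt1P[c [d [/setIP[cg ch] /setIP[dg dh] cd]]] := ltnW (capB g h0).
  have /row_stabP[_ [sigma sa sg]] := altg c d a b cg dg aB bB cd ab.
  rewrite -(card_imset _ (@perm_inj _ sigma)); apply: subset_leq_card.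
  apply/subsetP => _ /imsetP[h + ->]; rewrite !inE => /andP[hg /eqP vh].
  have /row_autP[_ s2 _] := sa.
  rewrite -{1}sg -s2 hg /=; apply/eqP/ffunP => r.
  (* [h] has the same value as [h0], and [c], [d] lie in [B h0], so induction at [h0] absorbs (c
     d). *)
  by rewrite (perm_val_aut _ _ _ sa) vh tvE -vh0 -mulgA; exact: IH.
have eN q : N (tv q) = N q.
  by apply/eqP; rewrite eqn_leq leN andbT; have := leN (tv q); rewrite tvK.
have count_N f q : count_mem q [seq f h | h <- enum (cchild g)] =
    #|[set h in cchild g | f h == q]|.
  by rewrite count_map -sum1_count big_enum_cond /= sum1dep_card; apply: eq_card => h; rewrite !inE.
have pe : perm_eq [seq tv (perm_val k h) | h <- enum (cchild g)]
                  [seq perm_val k h | h <- enum (cchild g)].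
  apply/allP => q _ /=; rewrite !count_N -/(N q) -eN; apply/eqP/eq_card => h.
  by rewrite !inE (can2_eq tvK tvK).
have big_tv (idx : F) (op : Monoid.com_law idx) :
    \big[op/idx]_(h in cchild g) perm_val k h (tperm a b * p) =
    \big[op/idx]_(h in cchild g) perm_val k h p.
  transitivity (\big[op/idx]_(q <- [seq tv (perm_val k h) | h <- enum (cchild g)]) q p).
    by rewrite big_map big_enum; apply: eq_bigr => h _; rewrite tvE.
  by rewrite (perm_big _ pe) big_map big_enum.
rewrite !perm_valS; case E: (clabel g) => [i j|c||] //; try exact: big_tv.
(* At a variable gate the stabiliser fixes the row [i], while 3-cycles on [B g] would move [a] and
   [b]; hence [i] is neither. *)
have stab_fix s : s \in row_stab g -> s i = i.
  case/row_stabP => _ [sigma /row_autP[s1 _ _] sg].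
  by have := s1 g; rewrite sg E /= => -[].
have [c cB /andP[ca cb]] : exists2 c, c \in B g & (c != a) && (c != b).
  have : [set a; b] \proper B g.
    rewrite properEcard subUset !sub1set aB bB cards2 ab.
    by have := capB g g; rewrite setIid.
  by case/properP => _ [c cB]; rewrite !inE negb_or => cab; exists c.
have ia : a != i.
  apply/eqP => ai; have bc : b != c by rewrite eq_sym.
  have := stab_fix _ (altg a b b c aB bB bB cB ab bc).
  by rewrite -ai permM tpermL tpermL => /eqP; rewrite (negPf ca).
have ib : b != i.
  apply/eqP => bi; have ac : a != c by rewrite eq_sym.
  have := stab_fix _ (altg a b a c aB bB aB cB ab ac).
  by rewrite -bi permM tpermR tpermL => /eqP; rewrite (negPf cb).
by rewrite permM tpermD.
Qed.

(** * The determinant at permutation matrices and the size bound *)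

Lemma det_poly_perm p :
  ((det_poly F n).@[fun e => mxvec (perm_mx p) ord0 e] = (-1) ^+ odd_perm p)%R.
Proof.
rewrite -det_map_mx -det_perm; congr (\det _)%R.
by apply/matrixP => i j; rewrite !mxE /= mevalXU mxvecE !mxE.
Qed.

Lemma symmetric_det_size (m : nat) :
  (2%:R != 0 :> F)%R -> symmetric_wrt (AltxAlt n) C -> computes C (det_poly F n) ->
  24 * m + 2 < n -> 2 ^ m <= 2 * csize C.
Proof.
move=> char2 symC detC nm; rewrite leqNgt; apply/negP => szC.
have large g : exists B : {set 'I_n}, (#|~: B| <= 12 * m) && alt_on (row_stab_group g) B.
  have HAlt : row_stab_group g \subset 'Alt_('I_n).
    by apply/subsetP => s /row_stabP[].
  have card_stab : #|'I_n|`! < 2 ^ m * #|row_stab_group g|.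
    have n1 : 1 < #|'I_n| by rewrite card_ord; move: nm; clear; lia.
    (* The factor 2 is the index of Alt_n in Sym_n. *)
    rewrite -card_Alt //; apply: leq_ltn_trans (leq_mul (leqnn 2) (card_row_stab g symC)) _.
    by rewrite mulnA ltn_pmul2r // cardG_gt0.
  have [||B cB aB] := @alt_on_large _ _ HAlt m; last by exists B; rewrite cB.
    by move=> P Q; exact: swaps_in_subgroup.
  by rewrite card_ord; move: nm; clear; lia.
pose B g := xchoose (large g).
have cB g : #|~: B g| <= 12 * m by have /andP[] := xchooseP (large g).
have aB g : alt_on (row_stab_group g) (B g) by have /andP[] := xchooseP (large g).
(* Each set misses at most 12m points, so two of them share at least n - 24m > 2. *)
have capB g h : 2 < #|B g :&: B h|.
  have := cardsC (B g :&: B h); rewrite setCI card_ord => cE.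
  have : #|~: B g :|: ~: B h| <= 24 * m.
    apply: leq_trans (leq_card_setU _ _) _; have := leq_add (cB g) (cB h).
    by rewrite -mulnDl.
  by move: cE nm; clear; lia.
have /card_gt1P[a [b [+ + ab]]] := ltnW (capB (cout C) (cout C)).
rewrite setIid => aO bO.
(* At the output, the matrices of (a b) and of the identity get equal values, so -1 = 1. *)
have := perm_val_tperm aB capB (csize C) 1 aO bO ab.
rewrite !ffunE -/(gate_poly C) detC !det_poly_perm mulg1 odd_tperm ab odd_perm1 /=.
rewrite expr1 expr0 => /eqP; rewrite eq_sym -subr_eq0 opprK.
by rewrite -mulr2n (negPf char2).
Qed.

End RowSymmetry.

Theorem mainTheorem1 (F : fieldType) (charF0 : [pchar F]%R =i pred0) :
  ~ exists C : forall n : nat, circuit F n,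
      (forall n : nat, symmetric_wrt (AltxAlt n) (C n)
                       /\ computes (C n) (det_poly F n))
      /\ subexponential (fun n => csize (C n)).
Proof.
case=> C [symdet /(_ 100 isT)[N sub]].
have char2 : (2%:R != 0 :> F)%R by have := charF0 2; rewrite !inE /= => ->.
(* The 100th power of the size is at most 2^n, so the size is at most 2^(N+2), whereas the lower
   bound with m = N + 4 gives 2^(N+3). *)
set n := 100 * N.+2.
have [symC detC] := symdet n.
have nN : N <= n by rewrite /n; lia.
have sizeC : csize (C n) <= 2 ^ N.+2.
  by rewrite -(@leq_exp2r _ _ 100) // -expnM mulnC; exact: sub n nN.
have nlarge : 24 * (N.+2 + 2) + 2 < n by rewrite /n; lia.
have := symmetric_det_size char2 symC detC nlarge.
rewrite addn2 expnS leq_pmul2l // => /leq_trans/(_ sizeC).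
by rewrite leq_exp2l // ltnn.
Qed.
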